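(* Let $\Sigma$ be a closed orientable surface of genus $g\ge 2$ and let $$1\to \pi_1(\Sigma)\to \Gamma\to Q\to 1$$ be a short exact sequence of groups in which $\Gamma$ is a (finitely generated) Gromov hyperbolic group. Fix word metrics on $\pi_1(\Sigma)$ and $\Gamma$, and fix an identification $G:\mathbb{H}^2\to\pi_1(\Sigma)$ with base-point $x_0$ (an equivariant quasi-isometry with $G(x_0)=1$). Then there is a constant $c>0$, depending only on the word metrics (for the fixed identification), such that almost every geodesic ray in $\pi_1(\Sigma)$, sampled by Lebesgue measure under the identification with $\mathbb{H}^2$, makes linear progress with speed at least $c$ in the word metric $d_\Gamma$ on $\Gamma$. That is, for Lebesgue-almost every unit tangent direction at $x_0$, the unit speed hyperbolic geodesic ray $\gamma:[0,\infty)\to\mathbb{H}^2$ with $\gamma_0=x_0$ in that direction satisfies $$d_\Gamma\big(G(\gamma_0),G(\gamma_T)\big)\ \ge\ c\,T$$ for all $T$ sufficiently large (depending on $\gamma$).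
   Context: $\pi_1(\Sigma)$ is regarded as a subgroup of $\Gamma$ via the given inclusion. Word metrics are taken with respect to finite generating sets, where the generating set of $\Gamma$ contains a generating set of $\pi_1(\Sigma)$. Fix a hyperbolic metric on $\Sigma$, so that $\pi_1(\Sigma)$ acts on the universal cover $\mathbb{H}^2$ of $\Sigma$ by deck transformations (freely, isometrically, cocompactly). An identification of $\pi_1(\Sigma)$ with $\mathbb{H}^2$ is a $\pi_1(\Sigma)$-equivariant quasi-isometry $G:\mathbb{H}^2\to\pi_1(\Sigma)$ with a base-point $x_0\in\mathbb{H}^2$ such that $G(x_0)=1$; it is chosen once and for all. Geodesic rays in $\pi_1(\Sigma)$ are sampled by choosing hyperbolic rays from $x_0$ according to Lebesgue measure on the unit tangent circle at $x_0$ (equivalently, up to measure class, Lebesgue measure on $S^1=\partial_\infty\mathbb{H}^2$). No assumption is made on $Q$. *)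

(* Defs.v *)
From mathcomp Require Import all_boot all_order all_algebra.
From mathcomp Require Import all_classical all_reals all_analysis.

Set Implicit Arguments.
Unset Strict Implicit.
Unset Printing Implicit Defensive.

Import Order.TTheory GRing.Theory Num.Theory.
Import numFieldNormedType.Exports.

Local Open Scope classical_set_scope.
Local Open Scope ring_scope.

(** * Groups and word metrics *)

(* A multiplicative map between groups preserves 1 and inverses. *)
Definition short_exact (N G Q : groupType)
    (i : {multiplicative N -> G}) (p : {multiplicative G -> Q}) : Prop :=
  [/\ injective i,
      forall q : Q, exists x : G, p x = q
    & forall x : G, p x = 1%g <-> exists n : N, i n = x].

Definition is_word (G : groupType) (S w : seq G) : bool :=
  all (fun x => (x \in S) || ((x^-1)%g \in S)) w.

Definition generates (G : groupType) (S : seq G) : Prop :=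
  forall x : G, exists2 w, is_word S w & (\prod_(y <- w) y)%g = x.

Definition word_of_size (G : groupType) (S : seq G) (x : G) (n : nat) : Prop :=
  exists w, [/\ is_word S w, size w = n & (\prod_(y <- w) y)%g = x].

(* The least size of a word representing x; the value 0 for an x that no word
   represents does not occur when S generates G. *)
Definition word_length (G : groupType) (S : seq G) (x : G) : nat :=
  match pselect (exists n, `[< word_of_size S x n >]) with
  | left ex => ex_minn ex
  | right _ => 0%N
  end.

Definition word_dist (R : realType) (G : groupType) (S : seq G) (x y : G) : R :=
  (word_length S (x^-1 * y)%g)%:R.

Definition gromov_product (R : realType) (T : Type) (d : T -> T -> R)
    (w x y : T) : R :=
  (d x w + d y w - d x y) / 2.

Definition gromov_hyperbolic (R : realType) (T : Type) (d : T -> T -> R) :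
    Prop :=
  exists delta : R, forall w x y z : T,
    Num.min (gromov_product d w x y) (gromov_product d w y z) - delta
      <= gromov_product d w x z.

Definition hyperbolic_group (R : realType) (G : groupType) : Prop :=
  exists2 S : seq G, generates S & gromov_hyperbolic (@word_dist R G S).

(* P is the fundamental group of the closed orientable surface of genus g: it
   has the presentation
     < a_1, b_1, ..., a_g, b_g | [a_1, b_1] ... [a_g, b_g] = 1 >,
   expressed by the universal property of a presented group.  With the library
   convention [x, y] = x^-1 y^-1 x y, replacing each generator by its inverse
   gives the presentation with the other usual commutator. *)
Definition surface_group (g : nat) (P : groupType) : Prop :=
  exists a b : 'I_g -> P,
    (\prod_(k < g) [~ a k, b k])%g = 1%g /\
    forall (H : groupType) (a' b' : 'I_g -> H),
      (\prod_(k < g) [~ a' k, b' k])%g = 1%g ->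
      (exists f : {multiplicative P -> H},
         forall k, f (a k) = a' k /\ f (b k) = b' k) /\
      (forall f1 f2 : {multiplicative P -> H},
         (forall k, f1 (a k) = f2 (a k) /\ f1 (b k) = f2 (b k)) -> f1 =1 f2).

(** * The hyperbolic plane, as the upper half-plane *)

Record H2 (R : realType) := MkH2 {
  coords :> R * R;
  coords2_gt0 : 0 < coords.2 }.

(* arcosh u = ln (u + sqrt (u^2 - 1)), for u >= 1 *)
Definition arcosh (R : realType) (u : R) : R :=
  ln (u + Num.sqrt (u ^+ 2 - 1)).

(* The distance of the Riemannian metric (dx^2 + dy^2) / y^2. *)
Definition hyp_dist (R : realType) (z w : H2 R) : R :=
  arcosh (1 + ((z.1 - w.1) ^+ 2 + (z.2 - w.2) ^+ 2) / (2 * z.2 * w.2)).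

(* Only the restriction of gamma to [0, +oo) matters. *)
Definition geodesic_ray (R : realType) (gamma : R -> H2 R) : Prop :=
  forall s t : R, 0 <= s -> 0 <= t ->
    hyp_dist (gamma s) (gamma t) = `|s - t|.

(* The initial velocity of gamma is y (cos th, sin th), where y is the second
   coordinate of gamma 0.  As the Riemannian norm at gamma 0 is the Euclidean
   norm divided by y, these are exactly the unit tangent vectors at gamma 0,
   and th is the Riemannian angle that parametrizes the unit tangent circle. *)
Definition initial_direction (R : realType) (gamma : R -> H2 R) (th : R) :
    Prop :=
  (fun t : R => t^-1 * ((gamma t).1 - (gamma 0).1)) @ 0^'+
      --> (gamma 0).2 * cos th /\
  (fun t : R => t^-1 * ((gamma t).2 - (gamma 0).2)) @ 0^'+
      --> (gamma 0).2 * sin th.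

(* A compact subset of the upper half-plane, for the topology of R * R; this is
   also the topology of hyp_dist. *)
Definition compact_H2 (R : realType) (K : set (H2 R)) : Prop :=
  compact (@coords R @` K).

(* The action by deck transformations of the fundamental group P of a closed
   hyperbolic surface on its universal cover: the surface is the quotient of H2
   by this action. *)
Record deck_action (R : realType) (P : groupType)
    (act : P -> H2 R -> H2 R) : Prop := {
  deck_act1 : forall z, act 1%g z = z;
  deck_actM : forall h k z, act (h * k)%g z = act h (act k z);
  deck_isometric : forall h z w, hyp_dist (act h z) (act h w) = hyp_dist z w;
  deck_free : forall h z, act h z = z -> h = 1%g;
  deck_properly_discontinuous : forall K : set (H2 R), compact_H2 K ->
    finite_set [set h : P | exists2 z, K z & K (act h z)];
  deck_cocompact : exists2 K : set (H2 R), compact_H2 K &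
    forall z, exists h, K (act h z) }.

Definition quasi_isometry (R : realType) (X Y : Type) (dX : X -> X -> R)
    (dY : Y -> Y -> R) (f : X -> Y) : Prop :=
  exists K C : R,
    [/\ 1 <= K, 0 <= C,
        forall x x', K^-1 * dX x x' - C <= dY (f x) (f x') <= K * dX x x' + C
      & forall y, exists x, dY (f x) y <= C].

Record identification (R : realType) (P : groupType) (S : seq P)
    (act : P -> H2 R -> H2 R) (x0 : H2 R) (G : H2 R -> P) : Prop := {
  ident_equivariant : forall h z, G (act h z) = (h * G z)%g;
  ident_quasi_isometry : quasi_isometry (@hyp_dist R) (@word_dist R P S) G;
  ident_basepoint : G x0 = 1%g }.

(* Main.v *)
Require Import Defs.
From mathcomp Require Import all_boot all_order all_algebra.
From mathcomp Require Import all_classical all_reals all_analysis.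
From mathcomp Require Import ring lra.

Import Order.TTheory GRing.Theory Num.Theory.
Import numFieldNormedType.Exports.

Local Open Scope classical_set_scope.
Local Open Scope ring_scope.

(** Linear progress holds because a ball of a finitely generated group grows
    at most exponentially, while the hyperbolic plane spreads geodesic rays
    exponentially fast.

    Two points of the plane with the same image under the identification lie at
    distance at most D, since the identification is a quasi-isometry and the
    fibre group embeds in the ambient group.  Two rays from the base-point that
    pass, at times at least m, through points at distance at most D have
    directions that differ by O(exp(- m)) ([directions_close]).  Hence the
    directions of the rays whose image in the ambient group takes a given value
    at a time at least m form a set of measure O(exp(- m))
    ([hitting_directions_cover]).

    Let k be twice the number of generators of the ambient group, plus one, so
    that inverses and the identity count as letters.  A ray that is slower than
    c = 1 / (2 k) at some time in [n + 1, n + 2) visits one of at most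
    k ^ ((n + 2) / (2 k)) elements, and this number is at most exp((n + 2) / 2)
    because k <= exp k.  The measure of the slow directions at time about n is
    therefore O(exp(- n / 2)) ([slow_directions_cover]), which is summable, and
    the Borel-Cantelli lemma shows that almost every direction is slow at a
    bounded set of times only.

    The spreading of geodesics is computed in the hyperboloid model centred at
    the base-point, where the hyperbolic cosine of the distance is a bilinear
    form and a ray with direction th is
    (cosh t, sinh t cos th, sinh t sin th) ([mink_ray]). *)

Set Implicit Arguments.
Unset Strict Implicit.
Unset Printing Implicit Defensive.

(** * Hyperbolic functions *)

Definition cosh (R : realType) (x : R) : R := (expR x + expR (- x)) / 2.
Definition sinh (R : realType) (x : R) : R := (expR x - expR (- x)) / 2.

Lemma coshB (R : realType) (x y : R) :
  cosh (x - y) = cosh x * cosh y - sinh x * sinh y.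
Proof. by rewrite /cosh /sinh opprB !expRD; field. Qed.

Lemma cosh_norm (R : realType) (x : R) : cosh `|x| = cosh x.
Proof.
have [x0|x0] := leP 0 x; first by rewrite ger0_norm.
by rewrite ltr0_norm// /cosh opprK addrC.
Qed.

Lemma cosh_ge0 (R : realType) (x : R) : 0 <= cosh x.
Proof. by rewrite divr_ge0 ?addr_ge0 ?expR_ge0. Qed.

Lemma sinh_ge0 (R : realType) (x : R) : 0 <= x -> 0 <= sinh x.
Proof. by move=> x0; rewrite divr_ge0// subr_ge0 ler_expR; lra. Qed.

Lemma expR_le_sinh (R : realType) (x : R) : 1 <= x -> expR x / 4 <= sinh x.
Proof.
move=> x1; rewrite /sinh.
have ex2 : 2 <= expR x by apply: le_trans (expR_ge1Dx x); lra.
have ef := expRxMexpNx_1 x.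
have f0 := expR_ge0 (- x).
nra.
Qed.

Lemma arcosh_ge0 (R : realType) (u : R) : 1 <= u -> 0 <= arcosh u.
Proof.
by move=> u1; rewrite ln_ge0// (le_trans u1)// lerDl sqrtr_ge0.
Qed.

Lemma arcoshK (R : realType) (u : R) : 1 <= u -> cosh (arcosh u) = u.
Proof.
move=> u1; rewrite /cosh /arcosh expRN lnK; last first.
  by rewrite posrE ltr_wpDr ?sqrtr_ge0// (lt_le_trans ltr01).
have s2 : Num.sqrt (u ^+ 2 - 1) ^+ 2 = u ^+ 2 - 1.
  by rewrite sqr_sqrtr// subr_ge0 exprn_ege1.
have s0 := sqrtr_ge0 (u ^+ 2 - 1).
set s := Num.sqrt _ in s2 s0 *.
have -> : (u + s)^-1 = u - s.
  apply: (@mulfI _ (u + s)); first by rewrite gt_eqF//; lra.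
  by rewrite divff; [nra|rewrite gt_eqF//; lra].
by field.
Qed.

(** * Geodesic rays in the hyperboloid model *)

(** The three functions [minkT], [minkX], [minkY] are the coordinates of z in
    the hyperboloid model T^2 - X^2 - Y^2 = 1, T > 0, placed so that z0 has
    coordinates (1, 0, 0) and so that X and Y point in the directions of the
    Euclidean axes at z0. *)
Definition minkT (R : realType) (z0 z : H2 R) : R :=
  ((z.1 - z0.1) ^+ 2 + z.2 ^+ 2 + z0.2 ^+ 2) / (2 * z0.2 * z.2).
Definition minkX (R : realType) (z0 z : H2 R) : R := (z.1 - z0.1) / z.2.
Definition minkY (R : realType) (z0 z : H2 R) : R :=
  ((z.1 - z0.1) ^+ 2 + z.2 ^+ 2 - z0.2 ^+ 2) / (2 * z0.2 * z.2).

(** The reason for these coordinates: the distance of two arbitrary points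
    becomes minus the Minkowski product. *)
Lemma cosh_hyp_dist (R : realType) (z0 z w : H2 R) :
  cosh (hyp_dist z w) = minkT z0 z * minkT z0 w -
    minkX z0 z * minkX z0 w - minkY z0 z * minkY z0 w.
Proof.
rewrite arcoshK; last first.
  by rewrite lerDl divr_ge0 ?addr_ge0 ?sqr_ge0// !mulr_ge0// ltW ?coords2_gt0.
case: z z0 w => [[a b] /= b0] [[x y] /= y0] [[u v] /= v0].
by rewrite /minkT /minkX /minkY /=; field; rewrite !gt_eqF.
Qed.

Lemma hyp_dist_ge0 (R : realType) (z w : H2 R) : 0 <= hyp_dist z w.
Proof.
apply: arcosh_ge0.
by rewrite lerDl divr_ge0 ?addr_ge0 ?sqr_ge0// !mulr_ge0// ltW ?coords2_gt0.
Qed.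

Lemma mink_base (R : realType) (z0 : H2 R) :
  [/\ minkT z0 z0 = 1, minkX z0 z0 = 0 & minkY z0 z0 = 0].
Proof.
case: z0 => [[a b] /= b0].
by rewrite /minkT /minkX /minkY /=; split; field; rewrite ?gt_eqF.
Qed.

Lemma minkT_ray (R : realType) (gamma : R -> H2 R) (t : R) :
  geodesic_ray gamma -> 0 <= t -> minkT (gamma 0) (gamma t) = cosh t.
Proof.
move=> ray t0; have := cosh_hyp_dist (gamma 0) (gamma 0) (gamma t).
have [-> -> ->] := mink_base (gamma 0).
by rewrite mul1r !mul0r !subr0 ray// cosh_norm /cosh sub0r opprK addrC.
Qed.

(** With [mink_norm_ray], this is the equality case of Cauchy-Schwarz for the
    space parts (X, Y) of two points of a ray: cosh t cosh s minus this product
    must be cosh (s - t).  So all space parts of a ray are parallel, which is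
    the uniqueness of the geodesic between two points. *)
Lemma mink_inner_ray (R : realType) (gamma : R -> H2 R) (s t : R) :
  geodesic_ray gamma -> 0 <= s -> 0 <= t ->
  minkX (gamma 0) (gamma s) * minkX (gamma 0) (gamma t) +
  minkY (gamma 0) (gamma s) * minkY (gamma 0) (gamma t) = sinh s * sinh t.
Proof.
move=> ray s0 t0; have := cosh_hyp_dist (gamma 0) (gamma s) (gamma t).
by rewrite ray// cosh_norm coshB !minkT_ray//; lra.
Qed.

Lemma mink_norm_ray (R : realType) (gamma : R -> H2 R) (t : R) :
  geodesic_ray gamma -> 0 <= t ->
  minkX (gamma 0) (gamma t) ^+ 2 + minkY (gamma 0) (gamma t) ^+ 2 = sinh t ^+ 2.
Proof. by move=> ray t0; have := mink_inner_ray ray t0 t0; rewrite -!expr2. Qed.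

Lemma mink_det_ray (R : realType) (gamma : R -> H2 R) (s t : R) :
  geodesic_ray gamma -> 0 <= s -> 0 <= t ->
  minkX (gamma 0) (gamma s) * minkY (gamma 0) (gamma t) =
  minkY (gamma 0) (gamma s) * minkX (gamma 0) (gamma t).
Proof.
move=> ray s0 t0; have := mink_inner_ray ray s0 t0.
have := mink_norm_ray ray s0; have := mink_norm_ray ray t0.
(* Lagrange's identity. *)
set x := minkX _ _; set y := minkY _ _.
set x' := minkX _ _; set y' := minkY _ _.
move=> et es est; apply/eqP; rewrite -subr_eq0 -sqrf_eq0.
have -> : (x' * y - y' * x) ^+ 2 =
  (x' ^+ 2 + y' ^+ 2) * (x ^+ 2 + y ^+ 2) - (x' * x + y' * y) ^+ 2 by ring.
by rewrite es et est; apply/eqP; ring.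
Qed.

Lemma eq_cvg_at_right (R : realType) (f h : R -> R) (a k l : R) :
  (forall t, a < t -> f t = h t) -> k = l ->
  f @ a^'+ --> k -> h @ a^'+ --> l.
Proof.
move=> fh <- fk; apply: cvg_trans fk; apply: near_eq_cvg.
near=> t; apply: fh; near: t; exact: nbhs_right_gt.
Unshelve. all: by end_near.
Qed.

(** The positive factor [m] clears the denominators of the coordinates, so that
    the limits follow from the two difference quotients alone. *)
Lemma mink_initial_direction (R : realType) (gamma : R -> H2 R) (th : R) :
  initial_direction gamma th ->
  let m t := t^-1 * (2 * (gamma 0).2 * (gamma t).2) in
  m t * minkX (gamma 0) (gamma t) @[t --> 0^'+]
    --> 2 * (gamma 0).2 ^+ 2 * cos th /\
  m t * minkY (gamma 0) (gamma t) @[t --> 0^'+]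
    --> 2 * (gamma 0).2 ^+ 2 * sin th.
Proof.
move=> [dx dy] m; set z0 := gamma 0 in dx dy m *.
have z00 : z0.2 != 0 by rewrite gt_eqF ?coords2_gt0.
have zt0 t : (gamma t).2 != 0 by rewrite gt_eqF ?coords2_gt0.
have id0 : (fun t : R => t) @ 0^'+ --> (0 : R).
  by apply: cvg_at_right_filter; exact: cvg_id.
have cX : (fun t : R => (gamma t).1 - z0.1) @ 0^'+ --> (0 : R).
  apply: (eq_cvg_at_right _ _ (cvgM id0 dx)); last exact: mul0r.
  by move=> t t0 /=; rewrite mulrA divff ?mul1r ?gt_eqF.
have cY : (fun t : R => (gamma t).2 - z0.2) @ 0^'+ --> (0 : R).
  apply: (eq_cvg_at_right _ _ (cvgM id0 dy)); last exact: mul0r.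
  by move=> t t0 /=; rewrite mulrA divff ?mul1r ?gt_eqF.
split.
- apply: (eq_cvg_at_right _ _ (cvgM (cvg_cst (2 * z0.2)) dx)); last by ring.
  by move=> t t0 /=; rewrite /m /minkX; field; rewrite (zt0 t) gt_eqF.
- apply: (eq_cvg_at_right _ _ (cvgD (cvgM dx cX)
    (cvgM dy (cvgD cY (cvg_cst (2 * z0.2)))))); last by ring.
  move=> t t0; rewrite !fctE /m /minkY /=; field.
  by rewrite z00 zt0 gt_eqF.
Qed.

(** The space part at time t is parallel to the space parts at small times, and
    positively so; its direction is then that of the limit of the latter,
    which is (cos th, sin th), and its length is sinh t. *)
Lemma mink_ray (R : realType) (gamma : R -> H2 R) (th t : R) :
  geodesic_ray gamma -> initial_direction gamma th -> 0 <= t ->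
  minkX (gamma 0) (gamma t) = sinh t * cos th /\
  minkY (gamma 0) (gamma t) = sinh t * sin th.
Proof.
move=> ray /mink_initial_direction; set m := fun t => _ => -[cX cY] t0.
have m_ge0 (s : R) : 0 < s -> 0 <= m s.
  by move=> s0; rewrite !mulr_ge0 ?invr_ge0 ?(ltW s0)// ltW ?coords2_gt0.
have norm_t := mink_norm_ray ray t0.
have det_t (s : R) : 0 < s -> _ := fun s0 => mink_det_ray ray (ltW s0) t0.
have inner_t (s : R) : 0 < s -> _ := fun s0 => mink_inner_ray ray (ltW s0) t0.
move: m cX cY m_ge0 norm_t det_t inner_t => m cX cY m_ge0.
move: (minkX _ (gamma t)) (minkY _ (gamma t)) => x y norm_t det_t inner_t.
have b0 : 0 < 2 * (gamma 0).2 ^+ 2.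
  by rewrite mulr_gt0// exprn_gt0// coords2_gt0.
set b := 2 * _ in cX cY b0.
have det0 : cos th * y = sin th * x.
  apply: (mulfI (lt0r_neq0 b0)); rewrite !mulrA.
  have lim1 : m s * minkX (gamma 0) (gamma s) * y @[s --> 0^'+]
      --> b * cos th * y.
    exact: cvgMr_tmp.
  have lim2 : m s * minkX (gamma 0) (gamma s) * y @[s --> 0^'+]
      --> b * sin th * x.
    apply: (eq_cvg_at_right _ _ (cvgM cY (cvg_cst x))) => // s s0 /=.
    by rewrite -[RHS]mulrA det_t// [RHS]mulrA.
  exact: (cvg_unique (@norm_hausdorff _ _) lim1 lim2).
have inner_ge0 : 0 <= cos th * x + sin th * y.
  rewrite -(pmulr_rge0 _ b0) mulrDr !mulrA.
  apply: (cvgr_to_ge (cvgD (cvgM cX (cvg_cst x)) (cvgM cY (cvg_cst y)))).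
  near=> s; have s0 : 0 < s by near: s; exact: nbhs_right_gt.
  change (0 <= m s * minkX (gamma 0) (gamma s) * x +
               m s * minkY (gamma 0) (gamma s) * y).
  rewrite -2!mulrA -mulrDr inner_t// mulr_ge0 ?m_ge0//.
  by rewrite mulr_ge0// sinh_ge0// ltW.
have inner : cos th * x + sin th * y = sinh t.
  apply/eqP; rewrite -(@eqrXn2 _ 2) ?sinh_ge0// -norm_t; apply/eqP.
  have cs := cos2Dsin2 th.
  have -> : (cos th * x + sin th * y) ^+ 2 =
    (cos th ^+ 2 + sin th ^+ 2) * (x ^+ 2 + y ^+ 2)
      - (cos th * y - sin th * x) ^+ 2 by ring.
  by rewrite cs det0 subrr expr0n subr0 mul1r.
have cs := cos2Dsin2 th; rewrite -inner; split.
- transitivity ((cos th ^+ 2 + sin th ^+ 2) * x); first by rewrite cs mul1r.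
  have -> : (cos th ^+ 2 + sin th ^+ 2) * x =
    cos th ^+ 2 * x + sin th * (sin th * x) by ring.
  by rewrite -det0; ring.
- transitivity ((cos th ^+ 2 + sin th ^+ 2) * y); first by rewrite cs mul1r.
  have -> : (cos th ^+ 2 + sin th ^+ 2) * y =
    cos th * (cos th * y) + sin th ^+ 2 * y by ring.
  by rewrite det0; ring.
Unshelve. all: by end_near.
Qed.

(** By the law of cosines the left side is
    cosh (hyp_dist (gamma t) (gamma' t')) - cosh (t - t'). *)
Lemma ray_endpoints_dist (R : realType) (gamma gamma' : R -> H2 R)
    (th th' t t' : R) :
  geodesic_ray gamma -> geodesic_ray gamma' -> gamma 0 = gamma' 0 ->
  initial_direction gamma th -> initial_direction gamma' th' ->
  0 <= t -> 0 <= t' ->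
  sinh t * sinh t' * (1 - cos (th - th'))
    <= cosh (hyp_dist (gamma t) (gamma' t')).
Proof.
move=> ray ray' e d d' t0 t0'.
rewrite (cosh_hyp_dist (gamma 0)) {2 4 6}e !minkT_ray//.
have [-> ->] := mink_ray ray d t0; have [-> ->] := mink_ray ray' d' t0'.
by have := cosh_ge0 (t - t'); rewrite coshB cosB; nra.
Qed.

(** * Divergence of rays *)

(** 1 - cos x = 2 sin (x / 2) ^ 2, and the mean value theorem gives
    sin (x / 2) = (x / 2) cos c with cos c ^ 2 >= cos (1 / 2) ^ 2 > 1 / 2. *)
Lemma one_sub_cos_ge (R : realType) (x : R) : `|x| <= 1 ->
  x ^+ 2 / 4 <= 1 - cos x.
Proof.
wlog x0 : x / 0 < x.
  move=> H; have [x0|x0|<-] := ltgtP 0 x; first exact: H.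
  - by rewrite -normrN -sqrrN -cosN; apply: H; rewrite oppr_gt0.
  - by rewrite cos0 expr0n mul0r subrr.
rewrite gtr0_norm// => x1.
have x20 : 0 < x / 2 by lra.
have [|c cI sE] := MVT x20 (f := @sin R) (df := cos).
  by apply: continuous_subspaceT => y; exact: continuous_sin.
move: cI sE; rewrite in_itv/= sin0 !subr0 => /andP[c0 cx] sE.
have half : cos (1 / 2 : R) ^+ 2 = (1 + cos 1) / 2.
  have := cos_mulr2n (1 / 2 : R).
  have -> : 1 / 2 *+ 2 = 1 :> R by rewrite -mulr_natr; field.
  by move=> ->; rewrite mulr2n; field.
have cc : cos (1 / 2) < cos c.
  have pi2 := @pi_ge2 R.
  by rewrite ltr_cos// ?in_itv/=; lra.
have := cos1_gt0 R; have c120 : 0 < cos (1 / 2 : R).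
  by have ? := @pi_ge2 R; apply: cos_gt0_pihalf; lra.
move=> c1; have := cos_mulr2n (x / 2); rewrite cos2sin2 sE.
have -> : x / 2 *+ 2 = x by rewrite -mulr_natr; field.
move=> ->.
have : 1 / 2 <= cos c ^+ 2 by nra.
rewrite -mulr_natr !exprMn; nra.
Qed.

(** The distance D forces 1 - cos (th - th') <= exp D / sinh m ^ 2, which is
    comparable with exp (D - 2 m).  Directions at distance at most 1 are
    compared, which excludes the pairs that are close only modulo 2 pi. *)
Lemma directions_close (R : realType) (gamma gamma' : R -> H2 R)
    (th th' t t' m D : R) :
  geodesic_ray gamma -> geodesic_ray gamma' -> gamma 0 = gamma' 0 ->
  initial_direction gamma th -> initial_direction gamma' th' ->
  1 <= m -> m <= t -> m <= t' -> hyp_dist (gamma t) (gamma' t') <= D ->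
  `|th - th'| <= 1 -> `|th - th'| <= 8 * expR (D / 2 - m).
Proof.
move=> ray ray' e d d' m1 mt mt' distD th1.
have t1 : 1 <= t by lra.
have t1' : 1 <= t' by lra.
have := ray_endpoints_dist ray ray' e d d' _ _.
move=> /(_ t t' ltac:(lra) ltac:(lra)) dist_ge.
have cos_ge := one_sub_cos_ge th1.
have coshD : cosh (hyp_dist (gamma t) (gamma' t')) <= expR D.
  have : expR (hyp_dist (gamma t) (gamma' t')) <= expR D by rewrite ler_expR.
  have : expR (- hyp_dist (gamma t) (gamma' t')) <= expR D.
    by rewrite ler_expR; have := hyp_dist_ge0 (gamma t) (gamma' t'); lra.
  by rewrite /cosh; lra.
have sinh_gem s : m <= s -> expR m / 4 <= sinh s.
  move=> ms; apply: le_trans (expR_le_sinh _); last lra.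
  by rewrite ler_pM2r// ler_expR.
have sinh2 : (expR m / 4) ^+ 2 <= sinh t * sinh t'.
  by rewrite expr2 ler_pM ?divr_ge0 ?expR_ge0// sinh_gem.
have sq : (expR m / 4) ^+ 2 * ((th - th') ^+ 2 / 4) <= expR D.
  apply: le_trans coshD; apply: le_trans dist_ge.
  by rewrite ler_pM ?divr_ge0 ?sqr_ge0.
have em0 := expR_gt0 m.
have : `|th - th'| ^+ 2 <= (8 * expR (D / 2 - m)) ^+ 2.
  rewrite real_normK ?num_real// expRD expRN 2!exprMn exprVn.
  rewrite -(expRM_natl 2) (_ : 2 * (D / 2) = D); last by field.
  rewrite mulrA ler_pdivlMr ?exprn_gt0//.
  by move: sq; rewrite expr_div_n; lra.
by rewrite ler_pXn2r// nnegrE mulr_ge0// expR_ge0.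
Qed.

(** * Measure estimates *)

Lemma borel_cantelli_geometric d (X : measurableType d) (R : realType)
    (mu : {measure set X -> \bar R}) (B : nat -> set X) (a z : R) :
  0 <= a -> 0 <= z < 1 -> (forall n, measurable (B n)) ->
  (forall n, (mu (B n) <= (a * z ^+ n)%:E)%E) ->
  mu (lim_sup_set B) = 0.
Proof.
move=> a0 /andP[z0 z1] mB muB; apply: lim_sup_set_cvg0 => //.
apply: (@le_lt_trans _ _ (\sum_(n <oo) (a * z ^+ n)%:E)%E).
  by apply: lee_nneseries => n _ //; exact: measure_ge0.
have -> : (\sum_(n <oo) (a * z ^+ n)%:E)%E = (a / (1 - z))%:E; last exact: ltry.
apply: cvg_lim => //.
have cv : series (geometric a z) @ \oo --> a / (1 - z).
  by apply: cvg_geometric_series; rewrite ger0_norm.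
under eq_fun do rewrite sumEFin.
by apply: cvg_EFin; [exact: nearW|exact: cv].
Qed.

(** The sets of directions below are defined by the existence of a ray, with no
    evident measurability; so they are enclosed in intervals. *)
Lemma cover_of_diameter (R : realType) (A : set R) (r : R) :
  0 <= r -> (forall x y, A x -> A y -> `|x - y| <= r) ->
  exists B : set R,
    [/\ measurable B, A `<=` B & (lebesgue_measure B <= (2 * r)%:E)%E].
Proof.
move=> r0 diamA; have [[x Ax]|nA] := pselect (exists x, A x); last first.
  exists set0; split=> //; last by rewrite measure0 lee_fin mulr_ge0.
  by move=> x Ax; case: nA; exists x.
exists `[x - r, x + r]%classic; split=> [//|y Ay|].
  by rewrite /= in_itv/= -ler_distl distrC diamA.
rewrite lebesgue_measure_itv/= lte_fin; case: ifPn => _; last first.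
  by rewrite lee_fin mulr_ge0.
by rewrite -EFinB lee_fin; lra.
Qed.

Lemma cover_of_seq d (X : measurableType d) (R : realType)
    (mu : {measure set X -> \bar R}) (I : eqType) (A : I -> set X) (b : R)
    (s : seq I) :
  (forall i, exists B,
     [/\ measurable B, A i `<=` B & (mu B <= b%:E)%E]) ->
  exists B, [/\ measurable B, forall i, i \in s -> A i `<=` B
    & (mu B <= ((size s)%:R * b)%:E)%E].
Proof.
move=> cov; elim: s => [|i s [B [mB AB muB]]].
  by exists set0; split; rewrite ?measure0 ?mul0r.
have [C [mC AC muC]] := cov i; exists (C `|` B); split.
- exact: measurableU.
- by move=> j; rewrite inE => /predU1P[->|/AB jB] y Ay; [left|right]; auto.
- rewrite (le_trans (measureU2 _ _ _))// /= -add1n natrD mulrDl.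
  by rewrite mul1r EFinD leeD.
Qed.

(** * Balls of word metrics *)

(** Adding the identity to the alphabet pads the words of at most n letters to
    length n, hence the base 2 |S| + 1. *)
Lemma word_ball_enum (G : groupType) (S : seq G) (n : nat) :
  generates S ->
  exists2 L : seq G, size L = ((size S).*2.+1 ^ n)%N &
    forall x, (word_length S x <= n)%N -> x \in L.
Proof.
move=> Sgen.
have [L sL wL] : exists2 L : seq G, size L = ((size S).*2.+1 ^ n)%N &
    forall w, is_word S w -> (size w <= n)%N -> (\prod_(y <- w) y)%g \in L.
  elim: n => [|n [L sL wL]].
    by exists [:: 1%g] => // -[|//] _ _; rewrite big_nil mem_seq1.
  pose A := 1%g :: S ++ [seq (x^-1)%g | x <- S].
  exists [seq (x * y)%g | x <- A, y <- L].
    by rewrite size_allpairs /= size_cat size_map sL addnn expnS.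
  move=> [_ _|x w /andP[xS wS] sw]; apply/allpairsP.
    have := wL [::] isT (leq0n n); rewrite big_nil => L1.
    by exists (1%g, 1%g); rewrite /= inE eqxx mulg1.
  exists (x, (\prod_(y <- w) y)%g); rewrite big_cons /= wL//; split=> //.
  rewrite inE mem_cat; case/orP: xS => [->|xS]; first by rewrite orbT.
  by rewrite -[x]invgK map_f ?invgK ?orbT.
exists L => // x; rewrite /word_length.
case: pselect => [ex|[]]; last first.
  by have [w wS <-] := Sgen x; exists (size w); apply/asboolP; exists w.
by case: ex_minnP => m /asboolP[w [wS <- <-]] _ mn; exact: wL.
Qed.

Lemma word_dist_refl (R : realType) (G : groupType) (S : seq G) (x : G) :
  word_dist R S x x = 0.
Proof.
rewrite /word_dist mulVg /word_length; case: pselect => //= ex.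
case: ex_minnP => m _ /(_ 0%N); rewrite leqn0 => m0.
suff /m0/eqP-> : `[< word_of_size S 1%g 0 >] by [].
by apply/asboolP; exists [::]; rewrite big_nil.
Qed.

(** * Slow directions *)

(** The directions that hit one value are split into the eight pieces
    [j, j + 1] of [0, 8], which contains [0, 2 pi], and [directions_close]
    bounds the diameter of each piece.  So 128 is 8 pieces, times 2 for the
    length of an interval around a set of given diameter, times the constant 8
    of that lemma. *)
Lemma hitting_directions_cover (R : realType) (X : eqType) (f : H2 R -> X)
    (x0 : H2 R) (D m : R) (s : seq X) :
  (forall z w, f z = f w -> hyp_dist z w <= D) -> 1 <= m ->
  exists B : set R, [/\ measurable B,
    forall th (gamma : R -> H2 R) t, 0 <= th < 2 * pi ->
      geodesic_ray gamma -> gamma 0 = x0 -> initial_direction gamma th ->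
      m <= t -> f (gamma t) \in s -> B th
    & (lebesgue_measure B <= ((size s)%:R * (128 * expR (D / 2 - m)))%:E)%E].
Proof.
move=> fD m1.
pose hit (j : nat) x := [set th : R | j%:R <= th <= j.+1%:R /\
  exists (gamma : R -> H2 R) t, [/\ geodesic_ray gamma, gamma 0 = x0,
    initial_direction gamma th, m <= t & f (gamma t) = x]].
have [|B [mB hitB muB]] := @cover_of_seq _ _ R lebesgue_measure _
  (fun jx : nat * X => hit jx.1 jx.2) (2 * (8 * expR (D / 2 - m)))
  [seq (j, x) | j <- iota 0 8, x <- s].
  move=> [j x] /=; apply: cover_of_diameter.
    by rewrite mulr_ge0// expR_ge0.
  move=> th th' [thj [gamma [t [ray g0 d mt ft]]]].
  move=> [thj' [gamma' [t' [ray' g0' d' mt' ft']]]].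
  apply: (directions_close ray ray' _ d d' m1 mt mt').
  - by rewrite g0 g0'.
  - by apply: fD; rewrite ft ft'.
  - by move: thj thj'; rewrite -natr1 ler_norml; lra.
exists B; split=> // [th gamma t /andP[th0 th2pi] ray g0 d mt fs|].
  have th8 : th < 8%:R by have := pihalf_lt2 R; lra.
  have /andP[th_ge th_lt] := truncn_itv th0.
  apply: (hitB (Num.truncn th, f (gamma t))).
    apply/allpairsP; exists (Num.truncn th, f (gamma t)); split=> //.
    by rewrite mem_iota add0n /= truncn_lt_nat.
  by split=> /=; [rewrite th_ge ltW|exists gamma, t].
apply: le_trans muB _; rewrite size_allpairs size_iota lee_fin natrM.
by rewrite le_eqVlt; apply/orP; left; apply/eqP; ring.
Qed.

(** A slow ray hits a ball of radius at most (n + 2) / (2 k) of the group, where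
    k = 2 |T| + 1 counts the letters; the ball has at most exp ((n + 2) / 2)
    elements because k <= exp k, and each of them is hit with measure
    O(exp (- n)).  The speed 1 / (2 k) is chosen to make the exponent of the
    product negative. *)
Lemma slow_directions_cover (R : realType) (Gam : groupType) (T : seq Gam)
    (f : H2 R -> Gam) (x0 : H2 R) (D : R) (n : nat) :
  generates T -> (forall z w, f z = f w -> hyp_dist z w <= D) ->
  exists B : set R, [/\ measurable B,
    forall th (gamma : R -> H2 R) t, 0 <= th < 2 * pi ->
      geodesic_ray gamma -> gamma 0 = x0 -> initial_direction gamma th ->
      n.+1%:R <= t < n.+2%:R ->
      (word_length T (f (gamma t)))%:R < (2 * (size T).*2.+1)%:R^-1 * t -> B th
    & (lebesgue_measure B <=
         (128 * expR (D / 2) * expR (- (1 / 2)) ^+ n)%:E)%E].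
Proof.
move=> Tgen fD; set k := (size T).*2.+1.
have [L sL wL] := word_ball_enum (n.+2 %/ (2 * k)) Tgen.
have n1 : 1 <= n.+1%:R :> R by rewrite ler1n.
have [B [mB hitB muB]] := hitting_directions_cover x0 L fD n1.
exists B; split=> // [th gamma t th2pi ray g0 d /andP[nt tn] slow|].
  apply: (hitB th gamma t) => //; apply: wL.
  rewrite leq_divRL ?muln_gt0// -(ler_nat R) natrM; apply: ltW.
  rewrite -ltr_pdivlMr ?ltr0n ?muln_gt0//; apply: (lt_trans slow).
  by rewrite mulrC ltr_pM2r// invr_gt0 ltr0n muln_gt0.
apply: le_trans muB _; rewrite lee_fin sL.
have ballE : (k ^ (n.+2 %/ (2 * k)))%:R <= expR (n.+2%:R / 2) :> R.
  rewrite natrX; apply: (@le_trans _ _ (expR k%:R ^+ (n.+2 %/ (2 * k)))).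
    rewrite lerXn2r ?nnegrE ?expR_ge0//.
    by apply: le_trans (expR_ge1Dx _); rewrite lerDr.
  rewrite -expRM_natl ler_expR ler_pdivlMr// -!natrM ler_nat.
  by rewrite -mulnA [(k * 2)%N]mulnC leq_trunc_div.
apply: (@le_trans _ _ (expR (n.+2%:R / 2) * (128 * expR (D / 2 - n.+1%:R)))).
  by rewrite ler_wpM2r// mulr_ge0// expR_ge0.
rewrite -expRM_natl mulrCA -mulrA -!expRD ler_pM2l// ler_expR.
by rewrite -[n.+2%:R]natr1 -[n.+1%:R]natr1; lra.
Qed.

Unset Implicit Arguments.

Theorem theorem1p1 (R : realType) (g : nat) (g_ge2 : (2 <= g)%N)
    (piS Gam Q : groupType)
    (i : {multiplicative piS -> Gam}) (p : {multiplicative Gam -> Q})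
    (piS_surface : surface_group g piS)
    (exact_ip : short_exact i p)
    (Gam_hyperbolic : hyperbolic_group R Gam)
    (S : seq piS) (S_gen : generates S)
    (T : seq Gam) (T_gen : generates T)
    (S_sub_T : forall s : piS, s \in S -> i s \in T)
    (act : piS -> H2 R -> H2 R) (act_deck : deck_action act)
    (x0 : H2 R) (G : H2 R -> piS) (G_ident : identification S act x0 G) :
  exists2 c : R, 0 < c &
    {ae (@lebesgue_measure R), forall th : R, 0 <= th < 2 * pi ->
      forall gamma : R -> H2 R,
        geodesic_ray gamma -> gamma 0 = x0 -> initial_direction gamma th ->
        \forall t \near +oo,
          c * t <= word_dist R T (i (G (gamma 0))) (i (G (gamma t)))}.
Proof.
have [i_inj _ _] := exact_ip.
have i1 : i 1%g = 1%g by apply: (mulgI (i 1%g)); rewrite -gmulfM !mulg1.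
have [K [C [K1 _ G_qi _]]] := ident_quasi_isometry G_ident.
have iG_dist z w : i (G z) = i (G w) -> hyp_dist z w <= K * C.
  move=> /i_inj Gzw; have /andP[+ _] := G_qi z w.
  by rewrite Gzw word_dist_refl subr_le0 ler_pdivrMl//; lra.
have cover n := slow_directions_cover x0 n T_gen iG_dist.
pose B n := sval (cid (cover n)).
have mB n : measurable (B n) by rewrite /B; case: cid => ? [].
exists (2 * (size T).*2.+1)%:R^-1; first by rewrite invr_gt0 ltr0n muln_gt0.
exists (lim_sup_set B); split.
- apply: bigcap_measurable => [|n _]; first by exists 0%N.
  by apply: bigcup_measurable => j _; exact: mB.
- apply: (@borel_cantelli_geometric _ _ R _ _ (128 * expR (K * C / 2))
    (expR (- (1 / 2)))) => //.
    by rewrite expR_ge0 expR_lt1; lra.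
  by move=> n; rewrite /B; case: cid => ? [].
move=> th /= slow n _; apply: contrapT => thB.
apply: slow => th2pi gamma ray g0 d.
near=> t.
(* The sets B are indexed by the integer part of the time, minus one. *)
have t_ge : n.+1%:R <= t by near: t; exact: nbhs_pinfty_ge.
have t0 : 0 <= t by apply: le_trans t_ge.
rewrite leNgt; apply/negP => slow; apply: thB.
have /andP[t_trunc trunc_t] := truncn_itv t0.
have trunc_gt : (n < Num.truncn t)%N by rewrite truncn_ge_nat.
have truncK : (Num.truncn t).-1.+1 = Num.truncn t.
  by apply: prednK; apply: leq_ltn_trans trunc_gt.
exists (Num.truncn t).-1; first by rewrite /= -ltnS truncK.
rewrite /B; case: cid => A [_ slowA _] /=.
apply: (slowA th gamma t) => //.
  by rewrite truncK t_trunc.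
move: slow; rewrite /word_dist g0 (ident_basepoint G_ident) i1 invg1.
by rewrite mul1g.
Unshelve. all: by end_near.
Qed.
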